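(* Let $\mathbb{K}$ be a field of characteristic zero, $S=\mathbb{K}[x_1,\dots,x_l]$, $\mathcal{A}$ a central hyperplane arrangement in $\mathbb{K}^l$, and $X,Y\in L(\mathcal{A})$ with $X\subseteq Y$. Then $I(Y)\in\mathrm{Ass}_S(S/J(\mathcal{A}))$ if and only if $I(Y)\in\mathrm{Ass}_S(S/J(\mathcal{A}_X))$.
   Context: A central arrangement $\mathcal{A}=\{H_1,\dots,H_n\}$ in $\mathbb{K}^l$ is a finite set of hyperplanes through the origin, $H_i=\alpha_i^{-1}(0)$ with $\alpha_i\in S$ linear forms; $Q(\mathcal{A})=\prod_i\alpha_i$. The Jacobian ideal $J(\mathcal{A})$ is the ideal of $S$ generated by $Q(\mathcal{A})$ and its partial derivatives. $L(\mathcal{A})=\{\bigcap_{H\in\mathcal{B}}H\mid \mathcal{B}\subseteq\mathcal{A}\}$. For $X\in L(\mathcal{A})$, $\mathcal{A}_X=\{H\in\mathcal{A}\mid X\subseteq H\}$ (an arrangement in $\mathbb{K}^l$), and $I(X)\subseteq S$ is the ideal generated by the $\alpha_i$ with $X\subseteq H_i$ (the vanishing ideal of $X$). *)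

(* Defs.v *)
From HB Require Import structures.
From mathcomp Require Import all_boot all_algebra.
From mathcomp Require Import boolp mpoly.

Set Implicit Arguments.
Unset Strict Implicit.
Unset Printing Implicit Defensive.

Import GRing.Theory.
Local Open Scope ring_scope.
Local Open Scope quotient_scope.

(* The quotient V / N of a module by a submodule. The quotient rings of
   ring_quotient.v are restricted to proper ideals, whereas a Jacobian ideal
   may be the whole ring; here N may be all of V. *)
Section QuotientModule.
Variables (R : pzRingType) (V : lmodType R) (N : submodClosed V).

Definition submod_pred : {pred V} := N.

Fact submod_pred_zmod_closed : zmod_closed submod_pred.
Proof. exact: submodClosedP N. Qed.

HB.instance Definition _ :=
  GRing.isZmodClosed.Build V submod_pred submod_pred_zmod_closed.

Definition quot_module := {ideal_quot submod_pred}.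
HB.instance Definition _ := GRing.Zmodule.on quot_module.
HB.instance Definition _ := EqQuotient.on quot_module.

Definition quot_scale (a : R) (x : quot_module) : quot_module :=
  \pi_quot_module (a *: repr x).

Lemma quot_module_eq (x y : V) :
  (\pi_quot_module x == \pi_quot_module y) = (x - y \in N).
Proof. by rewrite (Quotient.idealrBE submod_pred). Qed.

Lemma quot_moduleD (x y : V) :
  \pi_quot_module (x + y) = \pi_quot_module x + \pi_quot_module y.
Proof. exact: (Quotient.pi_add submod_pred). Qed.

Lemma quot_scaleE (a : R) (x : V) :
  quot_scale a (\pi_quot_module x) = \pi_quot_module (a *: x).
Proof.
apply/eqP; rewrite quot_module_eq -scalerBr; apply: rpredZ.
by rewrite -quot_module_eq reprK.
Qed.

Fact quot_scaleA a b x : quot_scale a (quot_scale b x) = quot_scale (a * b) x.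
Proof. by elim/quotW: x => x; rewrite (quot_scaleE b) !quot_scaleE scalerA. Qed.

Fact quot_scale1 : left_id 1 quot_scale.
Proof. by elim/quotW=> x; rewrite quot_scaleE scale1r. Qed.

Fact quot_scaleDr : right_distributive quot_scale +%R.
Proof.
move=> a; elim/quotW=> x; elim/quotW=> y.
by rewrite -quot_moduleD !quot_scaleE scalerDr quot_moduleD.
Qed.

Fact quot_scaleDl x : {morph quot_scale^~ x : a b / a + b}.
Proof.
by elim/quotW: x => x a b; rewrite !quot_scaleE scalerDl quot_moduleD.
Qed.

HB.instance Definition _ := GRing.Zmodule_isLmodule.Build R quot_module
  quot_scaleA quot_scale1 quot_scaleDr quot_scaleDl.

Lemma quot_moduleZ (a : R) (x : V) :
  \pi_quot_module (a *: x) = a *: \pi_quot_module x.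
Proof. by rewrite -quot_scaleE. Qed.

Lemma quot_module_eq0 (x : V) : (\pi_quot_module x == 0) = (x \in N).
Proof.
have -> : 0 = \pi_quot_module (0 : V).
  by rewrite -[0 in RHS](scale0r 0) quot_moduleZ scale0r.
by rewrite quot_module_eq subr0.
Qed.

End QuotientModule.

Section Ideals.
Variable R : comNzRingType.

(* Ideals of R, proper or not, are the submodules of R^o. *)
Definition ideal := submodClosed R^o.

Definition in_ideal_gen (gs : seq R) : {pred R^o} :=
  fun p : R => `[< exists c : 'I_(size gs) -> R, p = \sum_i c i * gs`_i >].

Fact in_ideal_gen_submod_closed gs :
  submod_closed (in_ideal_gen gs).
Proof.
split=> [|a p q /asboolP[c ->] /asboolP[d ->]]; apply/asboolP.
  by exists (fun=> 0); rewrite big1 // => i _; rewrite mul0r.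
exists (fun i => a * c i + d i); rewrite scaler_sumr -big_split /=.
by apply: eq_bigr => i _; rewrite mulrDl -mulrA.
Qed.

HB.instance Definition _ gs := GRing.isSubmodClosed.Build R R^o
  (in_ideal_gen gs) (in_ideal_gen_submod_closed gs).

Definition ideal_gen (gs : seq R) : ideal :=
  in_ideal_gen gs.

(* P \in Ass_R(M); idealr_closed includes properness. *)
Definition associated_prime (M : lmodType R) (P : {pred R}) : Prop :=
  [/\ idealr_closed P, prime_idealr_closed P &
      exists m : M, forall r, (r \in P) = (r *: m == 0)].

End Ideals.

Section Arrangements.
Variables (K : fieldType) (l : nat).

(* A linear form on K^l is given by its column of coefficients. *)
Definition lform (a : 'cV[K]_l) : {mpoly K[l]} := \sum_(j < l) a j 0 *: 'X_j.

Definition hyperplane (a : 'cV[K]_l) : {vspace 'rV[K]_l} :=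
  lker (linfun (mulmxr a)).

Lemma mem_hyperplane a (v : 'rV[K]_l) :
  (v \in hyperplane a) = ((lform a).@[v 0] == 0).
Proof.
have -> : (lform a).@[v 0] = (v *m a) 0 0.
  rewrite mxE /lform raddf_sum; apply: eq_bigr => j _ /=.
  by rewrite mevalZ mevalXU mulrC.
rewrite memv_ker lfunE /=; apply/eqP/eqP => [-> | va0]; first by rewrite mxE.
by apply/rowP => i; rewrite ord1 va0 mxE.
Qed.

(* Only the hyperplanes matter; the order of the list and the choice of the
   defining forms do not affect any of the ideals below. *)
Record arrangement := Arrangement {
  forms :> seq 'cV[K]_l;
  forms_neq0 : 0 \notin forms;
  forms_uniq : uniq [seq hyperplane a | a <- forms] }.

Implicit Types (A : arrangement) (X : {vspace 'rV[K]_l}).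

Definition Q A : {mpoly K[l]} := \prod_(a <- A) lform a.

Definition jacobian_gens A : seq {mpoly K[l]} :=
  Q A :: [seq (Q A)^`M(i) | i <- enum 'I_l].

Definition jacobian_ideal A : ideal {mpoly K[l]} := ideal_gen (jacobian_gens A).

Definition jacobian_algebra A : lmodType {mpoly K[l]} :=
  quot_module (jacobian_ideal A).

Definition lattice A X : Prop :=
  exists2 B : seq 'cV[K]_l, {subset B <= forms A} &
    X = (\bigcap_(a <- B) hyperplane a)%VS.

Definition forms_above A X := [seq a <- A | (X <= hyperplane a)%VS].

Fact forms_above_neq0 A X : 0 \notin forms_above A X.
Proof. by rewrite mem_filter negb_and forms_neq0 orbT. Qed.

Fact forms_above_uniq A X : uniq [seq hyperplane a | a <- forms_above A X].
Proof.
exact: subseq_uniq (map_subseq _ (filter_subseq _ _)) (forms_uniq A).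
Qed.

Definition localization A X : arrangement :=
  Arrangement (forms_above_neq0 A X) (forms_above_uniq A X).

Definition flat_ideal A X : ideal {mpoly K[l]} :=
  ideal_gen [seq lform a | a <- forms_above A X].

End Arrangements.

(* Main.v *)
(** Write [Q = Q_X * Q'], where [Q'] collects the forms not vanishing on [X].
    By the Leibniz rule [Q'^2 J(A_X) <= J(A) <= J(A_X)], and [Q'^2] lies outside
    the prime [I(Y)], because none of the factors of [Q'] vanishes on [Y].  So
    the two Jacobian ideals agree up to an element invertible at [I(Y)]: a
    witness [m] of [I(Y)] modulo [J(A)] is one modulo [J(A_X)], and conversely
    [Q'^2 m] is a witness modulo [J(A)] if [m] is one modulo [J(A_X)]. *)
Require Import Defs.
From mathcomp Require Import all_boot all_algebra.
From mathcomp Require Import boolp mpoly.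

Set Implicit Arguments.
Unset Strict Implicit.
Unset Printing Implicit Defensive.

Import GRing.Theory.
Local Open Scope ring_scope.
Local Open Scope quotient_scope.

Section IdealGen.
Variable R : comNzRingType.
Implicit Types (gs : seq R) (J : ideal R).

Lemma idealMl J (r x : R) : x \in J -> r * x \in J.
Proof. exact: (@rpredZ _ _ J). Qed.

Lemma mem_ideal_gen gs g : g \in gs -> g \in ideal_gen gs.
Proof.
move=> gs_g; have lt_g : (index g gs < size gs)%N by rewrite index_mem.
(* Kronecker delta at the first occurrence of [g], so repeated generators do no harm. *)
apply/asboolP; exists (fun i => (i == Ordinal lt_g)%:R).
rewrite (bigD1 (Ordinal lt_g)) //= eqxx mul1r nth_index // big1 ?addr0 //.
by move=> i /negPf->; rewrite mul0r.
Qed.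

Lemma ideal_gen_sub gs J :
  {in gs, forall g, g \in J} -> {subset ideal_gen gs <= J}.
Proof.
move=> gsJ _ /asboolP[c ->]; apply: (@rpred_sum _ J) => i _.
by apply: idealMl; apply: gsJ; apply: mem_nth.
Qed.

Lemma associated_prime_quotP J (P : {pred R}) :
  associated_prime (quot_module J) P <->
  [/\ idealr_closed P, prime_idealr_closed P &
      exists m : R, forall r, (r \in P) = (r * m \in J)].
Proof.
split=> -[closP prP [m Pm]]; split=> //.
  elim/quotW: m Pm => m Pm; exists m => r.
  by rewrite Pm -quot_moduleZ quot_module_eq0.
exists (\pi_(quot_module J) (m : R^o)) => r.
by rewrite Pm -quot_moduleZ quot_module_eq0.
Qed.

(** Multiplication by [s] is harmless outside [P]. The condition on [s] may assume [P] prime, since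
    either side of the equivalence supplies primality. *)
Lemma associated_prime_sandwich (J1 J2 : ideal R) (s : R) (P : {pred R}) :
    {subset J1 <= J2} -> (forall x, x \in J2 -> s * x \in J1) ->
    (prime_idealr_closed P -> s \notin P) ->
  associated_prime (quot_module J1) P <-> associated_prime (quot_module J2) P.
Proof.
move=> sJ12 sJ21 sP; split=> /associated_prime_quotP[closP prP [m Pm]];
  apply/associated_prime_quotP; split=> //.
  (* If [r * m] lies in [J2], then [s * r * m] lies in [J1], so [s * r] is in [P] and primality
     leaves [r]. *)
  exists m => r; apply/idP/idP => [|/sJ21]; first by rewrite Pm => /sJ12.
  by rewrite mulrA -Pm => /prP; rewrite (negPf (sP prP)).
exists (s * m) => r; apply/idP/idP => [|/sJ12].
  by rewrite Pm mulrCA => /sJ21.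
by rewrite mulrA -Pm => /prP; rewrite (negPf (sP prP)) orbF.
Qed.

(** Since [prime_idealr_closed] does not include properness, [1 \notin P] is assumed separately; it
    settles the empty product. *)
Lemma prime_idealr_prod (P : {pred R}) (I : eqType) (r : seq I) (p : pred I)
    (F : I -> R) :
    prime_idealr_closed P -> 1 \notin P ->
    (forall i, i \in r -> p i -> F i \notin P) ->
  \prod_(i <- r | p i) F i \notin P.
Proof.
move=> prP P1 FP; rewrite big_seq_cond.
apply: (big_ind (fun x => x \notin P)) => // [x y Px Py | i /andP[]]; last exact: FP.
by apply/negP => /prP; rewrite (negPf Px) (negPf Py).
Qed.

End IdealGen.

Section Localization.
Variables (K : fieldType) (l : nat).
Implicit Types (A : arrangement K l) (X Y : {vspace 'rV[K]_l}).

(** Evaluation at points of [Y] serves to refute membership in the ideal: each generator vanishes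
    there. *)
Lemma flat_ideal_meval A Y p v : p \in flat_ideal A Y -> v \in Y -> p.@[v 0] = 0.
Proof.
move=> /asboolP[c ->] Yv; rewrite raddf_sum big1 // => i _ /=.
rewrite mevalM; apply/eqP; rewrite mulf_eq0; apply/orP; right.
have /mapP[a] := mem_nth 0 (ltn_ord i).
rewrite mem_filter => /andP[/subvP sYa _] ->.
by rewrite -mem_hyperplane sYa.
Qed.

Lemma lform_flat_ideal A Y a : lform a \in flat_ideal A Y -> (Y <= hyperplane a)%VS.
Proof.
move=> Ia; apply/subvP => v Yv.
by rewrite mem_hyperplane (flat_ideal_meval Ia Yv).
Qed.

Lemma one_notin_flat_ideal A Y : 1 \notin flat_ideal A Y.
Proof.
(* Evaluate at the origin, a point of every [Y]. *)
apply/negP => /flat_ideal_meval /(_ (mem0v Y)) /eqP.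
by rewrite meval1 oner_eq0.
Qed.

Definition Qcompl A X : {mpoly K[l]} :=
  \prod_(a <- A | ~~ (X <= hyperplane a)%VS) lform a.

Lemma Q_localization A X : Q A = Q (localization A X) * Qcompl A X.
Proof. by rewrite /Q big_filter; apply: bigID. Qed.

(** A factor lying in the ideal would vanish on [Y], hence on the smaller [X], which the choice of
    factors excludes. *)
Lemma Qcompl_notin A X Y : (X <= Y)%VS ->
  prime_idealr_closed (flat_ideal A Y) -> Qcompl A X \notin flat_ideal A Y.
Proof.
move=> sXY prI; apply: prime_idealr_prod => // [|a _].
  exact: one_notin_flat_ideal.
by apply: contra => /lform_flat_ideal; apply: subv_trans.
Qed.

Lemma Q_jacobian A : Q A \in jacobian_ideal A.
Proof. by apply: mem_ideal_gen; rewrite mem_head. Qed.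

Lemma derivQ_jacobian A i : (Q A)^`M(i) \in jacobian_ideal A.
Proof. apply: mem_ideal_gen; apply/predU1P; right.
by apply/mapP; exists i; rewrite ?mem_enum. Qed.

Lemma jacobian_ideal_sub A (J : ideal {mpoly K[l]}) :
    Q A \in J -> (forall i, (Q A)^`M(i) \in J) ->
  {subset jacobian_ideal A <= J}.
Proof.
by move=> JQ JdQ; apply: ideal_gen_sub => g /predU1P[-> // | /mapP[i _ ->]].
Qed.

Lemma jacobian_sub_localization A X :
  {subset jacobian_ideal A <= jacobian_ideal (localization A X)}.
Proof.
apply: jacobian_ideal_sub => [|i]; rewrite (Q_localization A X).
  by rewrite mulrC; apply: idealMl; apply: Q_jacobian.
rewrite mderivM; apply: (@rpredD _ (jacobian_ideal (localization A X))).
  by rewrite mulrC; apply: idealMl; apply: derivQ_jacobian.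
by rewrite mulrC; apply: idealMl; apply: Q_jacobian.
Qed.

Lemma jacobian_localization_mul A X p :
  p \in jacobian_ideal (localization A X) ->
  Qcompl A X ^+ 2 * p \in jacobian_ideal A.
Proof.
set q := Qcompl A X; set QX := Q (localization A X) => /asboolP[c ->].
have defQ : Q A = QX * q := Q_localization A X.
rewrite mulr_sumr; apply: (@rpred_sum _ (jacobian_ideal A)) => i _.
rewrite mulrCA; apply: idealMl.
have /predU1P[-> | /mapP[j _ ->]] := mem_nth 0 (ltn_ord i).
  have -> : q ^+ 2 * QX = q * Q A by rewrite defQ expr2 -mulrA [q * QX]mulrC.
  by apply: idealMl; apply: Q_jacobian.
have -> : q ^+ 2 * QX^`M(j) = q * (Q A)^`M(j) - q^`M(j) * Q A.
  rewrite defQ mderivM mulrDr [q * (QX * _)]mulrCA [q^`M(j) * _]mulrCA.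
  by rewrite [q^`M(j) * q]mulrC addrK mulrCA [RHS]mulrC.
apply: (@rpredB _ (jacobian_ideal A)).
  by apply: idealMl; apply: derivQ_jacobian.
by apply: idealMl; apply: Q_jacobian.
Qed.

End Localization.

Theorem theorem4p2 (K : fieldType) (charK : [pchar K] =i pred0) (l : nat)
    (A : arrangement K l) (X Y : {vspace 'rV[K]_l})
    (LX : lattice A X) (LY : lattice A Y) (sXY : (X <= Y)%VS) :
  associated_prime (jacobian_algebra A) (flat_ideal A Y) <->
  associated_prime (jacobian_algebra (localization A X)) (flat_ideal A Y).
Proof.
apply: (@associated_prime_sandwich _ _ _ (Qcompl A X ^+ 2)).
- exact: jacobian_sub_localization.
- exact: jacobian_localization_mul.
(* A prime containing the square contains [Qcompl A X] itself. *)
move=> prI; apply/negP => /prI; rewrite orbb.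
exact/negP/Qcompl_notin.
Qed.
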